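(* Suppose that the potential $\Phi$ satisfies conditions (A1)--(A4) of the context, and let $I(u,a)=\Phi(u,a)+J(u)+K(a)$. Then there exists $(\bar u,\bar a)\in E\times S$ such that $$I(\bar u,\bar a)=\inf\{I(u,a)\,:\,u\in E,\ a\in S\}.$$ Furthermore, if $(u_n,a_n)_{n\ge1}$ is a minimising sequence satisfying $I(u_n,a_n)\to I(\bar u,\bar a)$, then there is a subsequence $(u_{n_k},a_{n_k})_{k\ge1}$ converging to $(\bar u,\bar a)$ (strongly) in $E\times S$.
   Context: Setting. $X$ is a separable Banach space, $\Lambda\subseteq\mathbb{R}^k$, $Y=\mathbb{R}^J$. Prior. $\mu_0$ is a Gaussian measure on $X$ with mean zero and Cameron-Martin space $(E,\langle\cdot,\cdot\rangle_E,\|\cdot\|_E)$. $\nu_0$ is a probability measure on $\Lambda$ with compact support $S\subseteq\Lambda$, absolutely continuous with respect to Lebesgue measure, with density $\rho$ continuous on $S$ and positive on $\mathrm{int}(S)$. Define $J(u)=\tfrac12\|u\|_E^2$ if $u\in E$, $J(u)=\infty$ if $u\notin E$; and $K(a)=-\log\rho(a)$ if $a\in\mathrm{int}(S)$, $K(a)=\infty$ if $a\notin S$, $K(a)=-\lim_{b\to a,\,b\in\mathrm{int}(S)}\log\rho(b)$ if $a\in\partial S$. Potential. $\Phi:X\times\Lambda\times Y\to\mathbb{R}$ satisfies: (A1) for every $\varepsilon>0$ there is $M_1(\varepsilon)\in\mathbb{R}$ such that for all $u\in X$ and all $a\in\Lambda$ (and all $y\in Y$), $\Phi(u,a;y)\ge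 M_1(\varepsilon)-\varepsilon\|u\|_X^2$; (A2) for each $u\in X$ and $y\in Y$, $\Phi(u,\cdot;y):\Lambda\to\mathbb{R}$ is continuous; (A3) there is a strictly positive $M_2:\mathbb{R}^+\times\mathbb{R}^+\times\mathbb{R}^+\to\mathbb{R}^+$, monotonic non-decreasing separately in each argument, such that for each $r>0$, $u\in X$, $a\in\Lambda$ and $y_1,y_2\in Y$ with $|y_1|,|y_2|<r$, $|\Phi(u,a;y_1)-\Phi(u,a;y_2)|\le M_2(r,\|u\|_X,|a|)|y_1-y_2|$; (A4) there is a strictly positive $M_3:\mathbb{R}^+\times\Lambda\times Y\to\mathbb{R}^+$, continuous in its second component, such that for each $r>0$, $a\in\Lambda$, $y\in Y$ and $u_1,u_2\in X$ with $\|u_1\|_X,\|u_2\|_X<r$, $|\Phi(u_1,a;y)-\Phi(u_2,a;y)|\le M_3(r,a,y)\|u_1-u_2\|_X$. The data $y\in Y$ is fixed and $\Phi(u,a)$ is written for $\Phi(u,a;y)$.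
   Formalization: Minimisers need not be unique, so the subsequence of a minimising sequence in E×S is shown to converge to some minimiser, not to a prescribed (ū,ā); every point of S is assumed to be a limit of points of int(S), so that K is defined on ∂S. *)

(* Defs.v *)
From HB Require Import structures.
From mathcomp Require Import all_boot all_order all_algebra.
From mathcomp Require Import all_classical all_reals all_analysis.
Set Implicit Arguments.
Unset Strict Implicit.
Unset Printing Implicit Defensive.
Import Order.TTheory GRing.Theory Num.Theory.
Import numFieldNormedType.Exports.
Local Open Scope classical_set_scope.
Local Open Scope ring_scope.

Notation borel T := (g_sigma_algebraType (@open T)).

Definition separable (T : topologicalType) : Prop :=
  exists D : set T, countable D /\ dense D.

Definition measure_support (R : realType) (T : ptopologicalType)
    (nu : {measure set (borel T) -> \bar R}) : set T :=
  [set x | forall U : set T, open U -> U x -> (0 < nu U)%E].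

(** The norm of the library on ['rV[R]_n] is the sup norm; this is the
    Euclidean one. *)
Definition eucl_norm (R : realType) (n : nat) (v : 'rV[R]_n) : R :=
  Num.sqrt (\sum_(i < n) v ord0 i ^+ 2).

(** Lebesgue measure on [R^k] is the unique Borel measure that gives every
    closed box its volume. *)
Definition is_lebesgue_rV (R : realType) (k : nat)
    (lam : {measure set (borel 'rV[R]_k) -> \bar R}) : Prop :=
  forall a b : 'rV[R]_k, (forall i, a ord0 i <= b ord0 i) ->
    lam [set x : 'rV[R]_k |
           forall i, a ord0 i <= x ord0 i /\ x ord0 i <= b ord0 i]
    = (\prod_(i < k) (b ord0 i - a ord0 i))%:E.

Definition has_density (R : realType) (k : nat)
    (lam nu : {measure set (borel 'rV[R]_k) -> \bar R})
    (rho : 'rV[R]_k -> R) : Prop :=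
  [/\ measurable_fun [set: borel 'rV[R]_k] rho,
      (forall x, 0 <= rho x) &
      forall A : set (borel 'rV[R]_k), measurable A ->
        nu A = (\int[lam]_(x in A) (rho x)%:E)%E].

(** Every continuous linear functional is a centred, possibly degenerate, real
    Gaussian variable.  The degenerate case is stated apart because
    [normal_prob 0 0] is the uniform law on [[0, 1]]. *)
Definition centred_gaussian (R : realType) (X : completeNormedModType R)
    (mu : probability (borel X) R) : Prop :=
  forall f : {linear X -> R^o}, continuous (f : X -> R^o) ->
    (forall B : set R, measurable B -> mu (f @^-1` B) = \d_(0 : R) B)
    \/ exists2 s : R, s != 0 &
         forall B : set R, measurable B -> mu (f @^-1` B) = normal_prob 0 s B.

(** [||h||_E = sup { f(h) : f in X^*, int f^2 dmu <= 1 }], which is [+oo]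
    exactly off the Cameron-Martin space (Bogachev, Gaussian Measures,
    section 2.2; [mu] has mean zero, so [int f^2 dmu] is the variance of [f]). *)
Definition cm_norm (R : realType) (X : completeNormedModType R)
    (mu : probability (borel X) R) (h : X) : \bar R :=
  ereal_sup [set (f h)%:E | f in
    [set f : {linear X -> R^o} | continuous (f : X -> R^o) /\
       (\int[mu]_x ((f x : R) ^+ 2)%:E <= 1)%E]].

Definition cm_space (R : realType) (X : completeNormedModType R)
    (mu : probability (borel X) R) : set X :=
  [set h | (cm_norm mu h < +oo)%E].

Definition J_prior (R : realType) (X : completeNormedModType R)
    (mu : probability (borel X) R) (u : X) : \bar R :=
  if `[< cm_space mu u >] then (2^-1 * fine (cm_norm mu u) ^+ 2)%:E else +oo%E.

(** [S] will be compact, so the points of [S] outside its interior form the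
    boundary of [S].  The limit is meaningful only at points adherent to the
    interior; elsewhere it is taken along an improper filter. *)
Definition K_prior (R : realType) (k : nat) (S : set 'rV[R]_k)
    (rho : 'rV[R]_k -> R) (a : 'rV[R]_k) : \bar R :=
  if `[< S° a >] then (- ln (rho a))%:E
  else if `[< S a >] then
    (- lim ((ln (rho b))%:E @[b --> within S° (nbhs a)]))%E
  else +oo%E.

Section potential.
Variables (R : realType) (X : completeNormedModType R) (k J : nat).
Variables (Lambda : set 'rV[R]_k) (Phi : X -> 'rV[R]_k -> 'rV[R]_J -> R).

Definition potential_A1 : Prop :=
  forall eps : R, 0 < eps -> exists M1 : R,
    forall u a y, Lambda a -> M1 - eps * `|u| ^+ 2 <= Phi u a y.

Definition potential_A2 : Prop :=
  forall u y, {within Lambda, continuous (fun a => Phi u a y)}.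

Definition potential_A3 : Prop :=
  exists M2 : R -> R -> R -> R,
    [/\ (forall r s t, 0 <= r -> 0 <= s -> 0 <= t -> 0 < M2 r s t),
        (forall r r' s t, 0 <= r -> r <= r' -> 0 <= s -> 0 <= t ->
           M2 r s t <= M2 r' s t),
        (forall r s s' t, 0 <= r -> 0 <= s -> s <= s' -> 0 <= t ->
           M2 r s t <= M2 r s' t),
        (forall r s t t', 0 <= r -> 0 <= s -> 0 <= t -> t <= t' ->
           M2 r s t <= M2 r s t') &
        forall r u a y1 y2, 0 < r -> Lambda a ->
          eucl_norm y1 < r -> eucl_norm y2 < r ->
          `|Phi u a y1 - Phi u a y2|
            <= M2 r `|u| (eucl_norm a) * eucl_norm (y1 - y2)].

Definition potential_A4 : Prop :=
  exists M3 : R -> 'rV[R]_k -> 'rV[R]_J -> R,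
    [/\ (forall r a y, 0 <= r -> Lambda a -> 0 < M3 r a y),
        (forall r y, 0 <= r -> {within Lambda, continuous (fun a => M3 r a y)}) &
        forall r a y u1 u2, 0 < r -> Lambda a ->
          `|u1| < r -> `|u2| < r ->
          `|Phi u1 a y - Phi u2 a y| <= M3 r a y * `|u1 - u2|].

End potential.

Definition objective (R : realType) (X : completeNormedModType R) (k : nat)
    (mu : probability (borel X) R) (S : set 'rV[R]_k) (rho : 'rV[R]_k -> R)
    (Phi_y : X -> 'rV[R]_k -> R) (u : X) (a : 'rV[R]_k) : \bar R :=
  ((Phi_y u a)%:E + J_prior mu u + K_prior S rho a)%E.

(* Main.v *)
Require Import Defs.
From HB Require Import structures.
From mathcomp Require Import all_boot all_order all_algebra.
From mathcomp Require Import finmap.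
From mathcomp Require Import all_classical all_reals all_analysis.
From mathcomp Require Import measurable_realfun ring lra.
Set Implicit Arguments.
Unset Strict Implicit.
Unset Printing Implicit Defensive.
Import Order.TTheory GRing.Theory Num.Theory.
Import numFieldNormedType.Exports.
Local Open Scope classical_set_scope.
Local Open Scope ring_scope.

(** Direct method.  (A1) and the embedding of the Cameron-Martin space [E] in [X] make
    [I] coercive, and balls of [E] are compact in [X], so a minimising sequence has a
    subsequence converging in [X * R^k].  [Phi] and [K] pass to the limit and the norm of
    [E] is lower semicontinuous for the topology of [X], so the limit is a minimiser and
    the norms converge; the parallelogram law then gives strong convergence in [E].

    Compactness of the balls of [E]: by separability, finitely many balls of radius [e]
    around points [d i] carry half of the mass of [mu].  A functional bounded by [1 / e]
    in norm and by [1] at the [d i] is at most [2] on them, hence, being Gaussian, has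
    variance at most [20 ^ 2].  Applying this to a Hahn-Banach functional for the gauge of
    the absolutely convex hull of the [d i] and the ball of radius [e] shows that the ball
    of radius [r] of [E] is within [21 r e] of a compact set. *)

(** * Sublinear functions and a Hahn-Banach functional touching at a point *)

Definition sublinear_fun {R : realType} {V : lmodType R} (p : V -> R) :=
  (forall x y, p (x + y) <= p x + p y) /\
  (forall (t : R) x, 0 <= t -> p (t *: x) <= t * p x).

Lemma le_infD {R : realType} (A B : set R) (m : R) :
  A !=set0 -> B !=set0 -> (forall a b, A a -> B b -> m <= a + b) ->
  m <= inf A + inf B.
Proof.
move=> A0 B0 mAB; rewrite -lerBlDl; apply: lb_le_inf => // b Bb.
rewrite lerBlDl -lerBlDr; apply: lb_le_inf => // a Aa.
by rewrite lerBlDr mAB.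
Qed.

Section hahn_banach.
Context {R : realType} {V : lmodType R}.
Implicit Types (p q : V -> R) (x y : V) (t : R).

Lemma sublinear_fun0 p : sublinear_fun p -> p 0 = 0.
Proof.
move=> [pD pZ]; have := pZ 0 0 (lexx _); have := pD 0 0.
by rewrite scale0r addr0 mul0r; lra.
Qed.

(** For [t > 0] the missing inequality is the assumed one at scale [1 / t], applied to [t *: x]. *)
Lemma sublinear_funZ p t x : sublinear_fun p -> 0 <= t -> p (t *: x) = t * p x.
Proof.
move=> sp; rewrite le_eqVlt => /predU1P[<-|t0].
  by rewrite scale0r mul0r sublinear_fun0.
apply/eqP; rewrite eq_le; apply/andP; split; first by apply: sp.2; exact: ltW.
rewrite -ler_pdivlMl// -[in leLHS](scale1r x) -(mulVf (lt0r_neq0 t0)) -scalerA.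
by apply: sp.2; rewrite invr_ge0 ltW.
Qed.

Lemma sublinear_fun_ge p x : sublinear_fun p -> - p (- x) <= p x.
Proof. by move=> sp; have := sp.1 x (- x); rewrite subrr sublinear_fun0//; lra. Qed.

(* The largest sublinear minorant [q] of [p] with [q (- y) <= - p y]. *)
Definition ray_minorant p y x := inf [set p (x + t *: y) - t * p y | t in [set t : R | 0 <= t]].

Lemma ray_minorant_le p y x t : sublinear_fun p -> 0 <= t ->
  ray_minorant p y x <= p (x + t *: y) - t * p y.
Proof.
move=> sp t0; apply: ge_inf; last by exists t.
exists (- p (- x)) => _ [s s0 <-]; have := sp.1 (x + s *: y) (- x).
by rewrite (addrC x) addrK sublinear_funZ//; lra.
Qed.

Lemma ray_minorant_sublinear p y : sublinear_fun p -> sublinear_fun (ray_minorant p y).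
Proof.
have ne x : [set p (x + t *: y) - t * p y | t in [set t : R | 0 <= t]] !=set0.
  by exists (p (x + 0 *: y) - 0 * p y), 0 => /=.
move=> sp; split=> [x z|l x l0].
  apply: le_infD => // _ _ [t /= t0 <-] [s /= s0 <-].
  apply: (le_trans (ray_minorant_le y (x + z) sp (addr_ge0 t0 s0))).
  have := sp.1 (x + t *: y) (z + s *: y).
  by rewrite scalerDl addrACA mulrDl; lra.
move: l0; rewrite le_eqVlt => /predU1P[<-|l0].
  rewrite scale0r mul0r; apply: (le_trans (ray_minorant_le y 0 sp (lexx 0))).
  by rewrite scale0r addr0 sublinear_fun0// mul0r subr0.
rewrite -ler_pdivrMl//; apply: lb_le_inf => // _ [t /= t0 <-].
rewrite ler_pdivrMl//.
apply: (le_trans (ray_minorant_le y (l *: x) sp (mulr_ge0 (ltW l0) t0))).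
by rewrite -scalerA -scalerDr sublinear_funZ ?(ltW l0)// mulrBr mulrA.
Qed.

(** Zorn's lemma for the reversed pointwise order. Along a chain the infimum at each point is finite
    because every member is at least [- p (- x)], and it is subadditive because, of two members, the
    smaller one can serve at both points. *)
Lemma sublinear_minimal p : sublinear_fun p -> exists q,
  [/\ sublinear_fun q, forall x, q x <= p x &
    forall q', sublinear_fun q' -> (forall x, q' x <= q x) -> forall x, q x <= q' x].
Proof.
move=> sp.
pose T := {q | sublinear_fun q /\ forall x, q x <= p x}.
pose t0 : T := exist _ p (conj sp (fun x => lexx (p x))).
pose le (s t : T) := `[< forall x, sval t x <= sval s x >].
have [||A Atot|[q [sq qp]] qmin] := @ZL_preorder T t0 le.
- by move=> t; apply/asboolP => x.
- move=> r s t /asboolP rs /asboolP st; apply/asboolP => x.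
  exact: le_trans (st x) (rs x).
- have [->|/set0P[a Aa]] := eqVneq A set0.
    by exists t0.
  pose F x := [set sval s x | s in A].
  have F0 x : F x !=set0 by exists (sval a x), a.
  have Flb x : has_lbound (F x).
    exists (- p (- x)) => _ [[s [ss sp']] As <-] /=.
    by apply: le_trans (sublinear_fun_ge x ss); rewrite lerN2.
  have qs x s : A s -> inf (F x) <= sval s x.
    by move=> As; apply: ge_inf => //; exists s.
  have sq : sublinear_fun (fun x => inf (F x)).
    split=> [x y|l x l0].
      apply: le_infD => // _ _ [s As <-] [t At <-].
      have [/asboolP st|/asboolP ts] := Atot _ _ As At.
        apply: (le_trans (qs _ _ At)); apply: (le_trans ((svalP t).1.1 x y)).
        by rewrite lerD2r.
      apply: (le_trans (qs _ _ As)); apply: (le_trans ((svalP s).1.1 x y)).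
      by rewrite lerD2l.
    move: l0; rewrite le_eqVlt => /predU1P[<-|l0].
      rewrite mul0r scale0r; apply: (le_trans (qs _ _ Aa)).
      by rewrite sublinear_fun0//; exact: (svalP a).1.
    rewrite -ler_pdivrMl//; apply: lb_le_inf => // _ [s As <-].
    rewrite ler_pdivrMl//; apply: (le_trans (qs _ _ As)).
    by apply: (svalP s).1.2; exact: ltW.
  have qp x : inf (F x) <= p x.
    by apply: (le_trans (qs _ _ Aa)); exact: (svalP a).2.
  exists (exist _ (fun x => inf (F x)) (conj sq qp)) => s As.
  by apply/asboolP => x /=; exact: qs.
exists q; split=> // q' sq' q'q.
have q'p x : q' x <= p x by exact: le_trans (qp x).
by have /asboolP := qmin (exist _ q' (conj sq' q'p)) (introT (asboolP _) q'q).
Qed.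

(** A minimal sublinear [q] is linear: [ray_minorant q y] lies below [q], so minimality makes them
    equal, and the parameter [t = 1] at [- y] gives [q (- y) <= - q y]. Minimising below
    [ray_minorant p x0] instead of [p] forces [q (- x0) <= - p x0], hence equality at [x0]. *)
Lemma hahn_banach_point p x0 : sublinear_fun p ->
  exists f : {linear V -> R^o}, (forall x, f x <= p x) /\ f x0 = p x0.
Proof.
move=> sp; have sr := ray_minorant_sublinear x0 sp.
have [q [sq qr qmin]] := sublinear_minimal sr.
have qN y : q (- y) = - q y.
  apply/eqP; rewrite eq_le; apply/andP; split; last first.
    by have := sublinear_fun_ge (- y) sq; rewrite opprK.
  have /(_ _ (- y)) := qmin _ (ray_minorant_sublinear y sq).
  move=> H; apply: le_trans (H _) _ => [x|].
    have := ray_minorant_le y x sq (lexx 0).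
    by rewrite scale0r addr0 mul0r subr0.
  have := ray_minorant_le y (- y) sq ler01.
  by rewrite scale1r addNr mul1r sublinear_fun0// sub0r.
have qD x y : q (x + y) = q x + q y.
  apply/eqP; rewrite eq_le sq.1/=.
  by have := sq.1 (x + y) (- y); rewrite addrK qN; lra.
have qlin : linear (q : V -> R^o).
  move=> a x y; rewrite qD; congr (_ + _).
  have [a0|a0] := leP 0 a; first exact: sublinear_funZ.
  rewrite -[in LHS](opprK a) scaleNr qN sublinear_funZ ?oppr_ge0 ?(ltW a0)//.
  by rewrite mulNr opprK.
pose qL := GRing.isLinear.Build R V R^o *:%R q qlin.
pose f : {linear V -> R^o} := HB.pack q qL.
have qp x : q x <= p x.
  apply: le_trans (qr x) _; have := ray_minorant_le x0 x sp (lexx 0).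
  by rewrite scale0r addr0 mul0r subr0.
exists f; split=> //=; apply/eqP; rewrite eq_le qp/= -[leRHS]opprK -qN lerNr.
apply: le_trans (qr _) _; have := ray_minorant_le x0 (- x0) sp ler01.
by rewrite scale1r addNr mul1r sublinear_fun0// sub0r.
Qed.

End hahn_banach.

(** * Second moment and small balls of a centred normal law *)

Section normal_moments.
Context {R : realType}.
Implicit Types s t x : R.
Local Notation leb := (@lebesgue_measure R).

(** The Radon-Nikodym derivative and [normal_pdf 0 s] have the same integral over every measurable
    set, so they agree almost everywhere. *)
Lemma ge0_integral_normal_prob s (f : R -> \bar R) :
  (forall x, 0 <= f x)%E -> measurable_fun [set: R] f ->
  (\int[normal_prob 0 s]_x f x = \int[leb]_x (f x * (normal_pdf 0 s x)%:E))%E.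
Proof.
move=> f0 mf.
have dom := normal_prob_dominates 0 s.
have mp : measurable_fun setT (fun x => (normal_pdf 0 s x)%:E).
  by apply/measurable_EFinP; exact: measurable_normal_pdf.
have RNi := Radon_Nikodym_SigmaFinite.f_integrable dom.
rewrite -(Radon_Nikodym_SigmaFinite.change_of_variables dom)//.
apply: ae_eq_integral => //.
- by apply: emeasurable_funM => //; exact: (measurable_int leb).
- exact: emeasurable_funM.
- apply: ae_eqe_mul2l; apply: integral_ae_eq => //= E _ mE.
  by rewrite -Radon_Nikodym_SigmaFinite.f_integral.
Qed.

Lemma normal_peak_double s : normal_peak s = 2 * normal_peak (2 * s).
Proof.
rewrite /normal_peak (_ : (2 * s) ^+ 2 * pi *+ 2 = 2 ^+ 2 * (s ^+ 2 * pi *+ 2)); last by ring.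
by rewrite sqrtrM// sqrtr_sqr ger0_norm// invfM mulrA divff ?mul1r.
Qed.

(** With [u = x^2 / (2 s^2)], the factor [exp (- u)] splits into [exp (- u / 4)], which belongs to
    the density of deviation [2 s], and [exp (- 3 u / 4)], which absorbs [u]. Integrating then
    bounds the second moment by a multiple of a total mass. *)
Lemma sqr_normal_pdf_le s x : s != 0 ->
  x ^+ 2 * normal_pdf 0 s x <= 6 * s ^+ 2 * normal_pdf 0 (2 * s) x.
Proof.
move=> s0; have s20 : 2 * s != 0 by rewrite mulf_neq0.
rewrite !normal_pdfE//= (normal_peak_double s) /normal_fun subr0.
have ss : 0 < s ^+ 2 by rewrite exprn_even_gt0.
set u := x ^+ 2 / (s ^+ 2 *+ 2).
have u0 : 0 <= u by rewrite divr_ge0 ?sqr_ge0// mulrn_wge0// ltW.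
have xu : x ^+ 2 = 2 * s ^+ 2 * u by rewrite /u; field.
have -> : - x ^+ 2 / (s ^+ 2 *+ 2) = - (u / 4) - (3 / 4 * u).
  by rewrite mulNr -/u; field.
have -> : - x ^+ 2 / ((2 * s) ^+ 2 *+ 2) = - (u / 4).
  by rewrite /u; field.
rewrite expRD xu; set e := expR (- (u / 4)); set P := normal_peak _.
have P0 : 0 <= P by exact: normal_peak_ge0.
have e0 : 0 <= e by exact: expR_ge0.
have ue : u * expR (- (3 / 4 * u)) <= 3 / 2.
  rewrite expRN ler_pdivrMr ?expR_gt0//.
  by have := expR_ge1Dx (3 / 4 * u); lra.
have -> : 2 * s ^+ 2 * u * (2 * P * (e * expR (- (3 / 4 * u)))) =
  4 * s ^+ 2 * P * e * (u * expR (- (3 / 4 * u))) by ring.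
have -> : 6 * s ^+ 2 * (P * e) = 4 * s ^+ 2 * P * e * (3 / 2) by field.
by apply: ler_wpM2l => //; rewrite 3?mulr_ge0//; exact: ltW.
Qed.

Lemma normal_second_moment_le s : s != 0 ->
  (\int[normal_prob 0 s]_x (x ^+ 2)%:E <= (6 * s ^+ 2)%:E)%E.
Proof.
move=> s0; rewrite ge0_integral_normal_prob; last 2 first.
- by move=> x; rewrite lee_fin sqr_ge0.
- by apply/measurable_EFinP; exact: exprn_measurable.
have mx : measurable_fun setT (fun x : R => (x ^+ 2)%:E).
  by apply/measurable_EFinP; exact: exprn_measurable.
have mp z : measurable_fun setT (fun x => (normal_pdf 0 z x)%:E).
  by apply/measurable_EFinP; exact: measurable_normal_pdf.
apply: (@le_trans _ _ (\int[leb]_x ((6 * s ^+ 2)%:E * (normal_pdf 0 (2 * s) x)%:E))%E).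
  apply: ge0_le_integral => //.
  - by move=> x _; rewrite -EFinM lee_fin mulr_ge0 ?sqr_ge0 ?normal_pdf_ge0.
  - by apply: emeasurable_funM; [exact: mx|exact: mp].
  - by apply: emeasurable_funM; [exact: measurable_cst|exact: mp].
  - by move=> x _; rewrite -!EFinM lee_fin sqr_normal_pdf_le.
rewrite ge0_integralZl//=.
- by rewrite integral_normal_pdf mule1.
- exact: mp.
- by move=> x _; rewrite lee_fin normal_pdf_ge0.
- by rewrite lee_fin mulr_ge0// sqr_ge0.
Qed.

(** The density never exceeds its peak, which is at most [1 / |s|]. A ball carrying half of the mass
    therefore bounds [s]. *)
Lemma normal_prob_ball_le s t : s != 0 -> 0 <= t ->
  (normal_prob 0 s [set x | (`|x| <= t)%R] <= (2 * t / `|s|)%:E)%E.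
Proof.
move=> s0 t0.
have -> : [set x | `|x| <= t] = `[(- t), t]%classic.
  by apply/seteqP; split=> x /=; rewrite in_itv/= ler_norml.
have mp : measurable_fun setT (fun x => (normal_pdf 0 s x)%:E).
  by apply/measurable_EFinP; exact: measurable_normal_pdf.
have : (\int[leb]_(x in `[(- t)%R, t]) (normal_pdf 0 s x)%:E <=
        \int[leb]_(x in `[(- t)%R, t]) (`|s|^-1)%:E)%E.
  apply: ge0_le_integral => //=.
  - by move=> x _; rewrite lee_fin normal_pdf_ge0.
  - exact/measurable_funTS.
  move=> x _; rewrite lee_fin; apply: (le_trans (normal_pdf_ub _ _ s0)).
  rewrite /normal_peak lef_pV2 ?posrE ?normr_gt0//; last first.
    by rewrite sqrtr_gt0 mulrn_wgt0// mulr_gt0 ?pi_gt0// exprn_even_gt0.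
  rewrite -sqrtr_sqr ler_wsqrtr// -mulrnAr ler_peMr ?sqr_ge0//.
  by have := pi_ge2 R; lra.
move/le_trans; apply.
rewrite integral_cst//= lebesgue_measure_itv/= lte_fin.
case: ltP => tt.
  by rewrite -EFinD -EFinM lee_fin opprK (_ : t + t = 2 * t) 1?mulrC//; ring.
by rewrite mule0 lee_fin divr_ge0// mulr_ge0.
Qed.

End normal_moments.

(** * Continuous functionals under a Gaussian measure *)

Lemma continuous_borel_measurable {R : realType} {T : ptopologicalType} (f : T -> R) :
  continuous f -> measurable_fun [set: borel T] f.
Proof.
move=> cf; apply: (measurability _ (RGenOpens.measurableE R)).
move=> _ [_ [a [b ->]] <-]; rewrite setTI.
by apply: sub_sigma_algebra; apply: open_comp => //; exact: interval_open.
Qed.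

Section gaussian_functionals.
Context {R : realType} {X : completeNormedModType R} (mu : probability (borel X) R).
Implicit Types f : {linear X -> R^o}.

(** For a law of deviation [s], the small-ball estimate gives [1 / 2 <= 2 t / |s|], so [|s| <= 4 t],
    and the second moment is at most [6 s^2 <= 96 t^2]. *)
Lemma gaussian_sqr_integral_le f (t : R) : centred_gaussian mu ->
  continuous (f : X -> R^o) -> 0 <= t ->
  ((2^-1)%:E <= mu [set x | (`|f x : R| <= t)%R])%E ->
  (\int[mu]_x ((f x : R) ^+ 2)%:E <= (96 * t ^+ 2)%:E)%E.
Proof.
move=> gm cf t0 ht.
have mf : measurable_fun [set: borel X] (f : X -> R).
  exact: continuous_borel_measurable.
have msq : measurable_fun [set: R] (fun x : R => (x ^+ 2)%:E).
  by apply/measurable_EFinP; exact: exprn_measurable.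
have mf' : measurable_fun [set: borel X] (f : X -> measurableTypeR R) by exact: mf.
have msq' : measurable_fun [set: measurableTypeR R] (fun x : R => (x ^+ 2)%:E) by exact: msq.
pose Z : {RV mu >-> measurableTypeR R} :=
  HB.pack (f : X -> measurableTypeR R) (isMeasurableFun.Build _ _ _ _ _ mf').
have -> : (\int[mu]_x ((f x : R) ^+ 2)%:E = \int[distribution mu Z]_y (y ^+ 2)%:E)%E.
  by rewrite ge0_integral_distribution// => y; rewrite lee_fin sqr_ge0.
have [law|[s s0 law]] := gm f cf.
  rewrite (eq_measure_integral (dirac (0 : measurableTypeR R)))/=; last first.
    by move=> A mA _; exact: law.
  by rewrite integral_dirac//= diracT mul1e expr0n/= lee_fin mulr_ge0 ?sqr_ge0.
have -> : (\int[distribution mu Z]_y (y ^+ 2)%:E =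
    \int[normal_prob 0 s]_y (y ^+ 2)%:E)%E.
  by apply: eq_measure_integral => A mA _; exact: law.
apply: (le_trans (normal_second_moment_le s0)).
rewrite lee_fin.
have mB : measurable [set x : R | `|x| <= t].
  rewrite (_ : [set x | _] = `[(- t), t]%classic)//.
  by apply/seteqP; split=> x /=; rewrite in_itv/= ler_norml.
have := normal_prob_ball_le s0 t0; rewrite -law// => /(le_trans ht).
rewrite lee_fin => H.
have st : `|s| <= 4 * t.
  have ns : 0 < `|s| by rewrite normr_gt0.
  by move: H; rewrite ler_pdivlMr//; lra.
rewrite -[s ^+ 2]real_normK ?num_real//.
have : `|s| ^+ 2 <= (4 * t) ^+ 2 by rewrite ler_sqr ?nnegrE ?mulr_ge0.
by rewrite exprMn; lra.
Qed.

(** The rescaled functional [f / s] is admissible in the supremum that defines [cm_norm]. *)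
Lemma cm_norm_fun_le_gt0 f h (r s : R) : continuous (f : X -> R^o) -> 0 < s ->
  (\int[mu]_x ((f x : R) ^+ 2)%:E <= (s ^+ 2)%:E)%E ->
  (cm_norm mu h <= r%:E)%E -> (f h : R) <= r * s.
Proof.
move=> cf s0 fs hr.
have mf : measurable_fun [set: borel X] (f : X -> R).
  exact: continuous_borel_measurable.
pose g : {linear X -> R^o} := s^-1 \*: f.
have gE x : (g x : R) = s^-1 * (f x : R) by [].
have : ((g h : R)%:E <= cm_norm mu h)%E.
  apply: ereal_sup_ubound; exists g => //; split.
    by move=> x; exact: (@cvgZl_tmp R R^o X _ _ s^-1 _ _ (cf x)).
  under eq_integral do rewrite gE exprMn EFinM.
  rewrite ge0_integralZl//=.
  - by rewrite muleC -lee_pdivlMr ?exprn_gt0 ?invr_gt0//; move: fs; rewrite exprVn invrK mul1e.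
  - by apply/measurable_EFinP; exact: measurable_funX.
  - by move=> x _; rewrite lee_fin sqr_ge0.
  - by rewrite lee_fin sqr_ge0.
move=> /le_trans /(_ hr); rewrite lee_fin gE mulrC ler_pdivrMr//.
Qed.

End gaussian_functionals.

(** * Gauge of a finite set thickened by a ball *)

Lemma rV_cube_compact {R : realType} (n : nat) (M : R) :
  compact [set v : 'rV[R]_n | forall i, `[(- M), M]%classic (v ord0 i)].
Proof.
by apply: (@rV_compact _ n (fun=> `[(- M), M]%classic)) => i; exact: segment_compact.
Qed.

Section span_gauge.
Context {R : realType} {X : normedModType R} {n : nat} (d : 'I_n -> X) (e : R).
Hypothesis e0 : 0 < e.
Implicit Types (x : X) (c : 'rV[R]_n).

Definition span_cost x c : R :=
  `|x - \sum_i c ord0 i *: d i| / e + \sum_i `|c ord0 i|.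

(* Gauge of the absolutely convex hull of the ball of radius [e] and the points [d i]. *)
Definition span_gauge x : R := inf (range (span_cost x)).

Lemma span_cost_ge0 x c : 0 <= span_cost x c.
Proof. by rewrite addr_ge0 ?divr_ge0 ?(ltW e0)// sumr_ge0. Qed.

Lemma has_inf_span_cost x : has_inf (range (span_cost x)).
Proof.
split; first by exists (span_cost x 0), 0.
by exists 0 => _ [c _ <-]; exact: span_cost_ge0.
Qed.

Lemma span_gauge_le x c : span_gauge x <= span_cost x c.
Proof. by apply: ge_inf; [case: (has_inf_span_cost x)|exists c]. Qed.

Lemma span_gauge_le_norm x : span_gauge x <= `|x| / e.
Proof.
apply: (le_trans (span_gauge_le x 0)); rewrite /span_cost.
rewrite big1 => [|i _]; last by rewrite mxE scale0r.
by rewrite subr0 big1 ?addr0// => i _; rewrite mxE normr0.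
Qed.

(** The scalars [1] and [-1] are the ones of interest: they bound a functional dominated by the
    gauge on both sides at [d i]. *)
Lemma span_gauge_le1 (b : R) i : `|b| = 1 -> span_gauge (b *: d i) <= 1.
Proof.
move=> b1; apply: (le_trans (span_gauge_le _ (b *: delta_mx ord0 i))).
rewrite /span_cost (bigD1 i)//= !mxE !eqxx mulr1 big1 ?addr0; last first.
  by move=> j ji; rewrite !mxE (negbTE ji) andbF mulr0 scale0r.
rewrite subrr normr0 mul0r add0r (bigD1 i)//= !mxE !eqxx mulr1 b1 big1 ?addr0//.
by move=> j ji; rewrite !mxE (negbTE ji) andbF mulr0 normr0.
Qed.

Lemma span_gauge_sublinear : sublinear_fun span_gauge.
Proof.
split=> [x y|t x t0].
  apply: le_infD.
  - by exists (span_cost x 0), 0.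
  - by exists (span_cost y 0), 0.
  move=> _ _ [c _ <-] [c' _ <-]; apply: (le_trans (span_gauge_le _ (c + c'))).
  rewrite /span_cost addrACA -mulrDl lerD//.
    rewrite ler_pM2r ?invr_gt0//; apply: le_trans (ler_normD _ _).
    under eq_bigr do rewrite mxE scalerDl.
    by rewrite big_split/= opprD addrACA.
  by rewrite -big_split/= ler_sum// => i _; rewrite mxE ler_normD.
move: t0; rewrite le_eqVlt => /predU1P[<-|t0].
  by rewrite scale0r mul0r (le_trans (span_gauge_le_norm 0))// normr0 mul0r.
rewrite -ler_pdivrMl//; apply: lb_le_inf; first by exists (span_cost x 0), 0.
move=> _ [c _ <-]; rewrite ler_pdivrMl//.
apply: (le_trans (span_gauge_le _ (t *: c))); rewrite /span_cost.
under eq_bigr do rewrite mxE -scalerA.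
under [X in _ + X]eq_bigr do rewrite mxE normrM gtr0_norm//.
by rewrite -scaler_sumr -mulr_sumr -scalerBr normrZ gtr0_norm// mulrDr mulrA.
Qed.

Lemma span_image_compact (M : R) :
  compact [set \sum_i c ord0 i *: d i |
    c in [set c : 'rV[R]_n | forall i, `[(- M), M]%classic (c ord0 i)]].
Proof.
apply: continuous_compact.
  apply: continuous_subspaceT => c.
  apply: cvg_big => [||i _]; [exact: add_continuous|exact: (nbhs_filter c)|].
  by apply: (@cvgZr_tmp R X); [exact: (nbhs_filter c)|exact: (@coord_continuous _ _ _ ord0 i c)].
exact: rV_cube_compact.
Qed.

End span_gauge.

(** * Separability, and compactness by approximation *)

Section separable_borel.
Context {R : realType} {X : completeNormedModType R}.

Lemma open_borel_measurable (A : set X) : open A -> measurable (A : set (borel X)).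
Proof. exact: sub_sigma_algebra. Qed.

(** The balls of radius [e] around a countable dense set cover [X], so by continuity from below
    finitely many of them have mass close to one. *)
Lemma separable_cover_half (mu : probability (borel X) R) (e : R) :
  separable X -> 0 < e -> exists n (d : 'I_n -> X),
  ((2^-1)%:E <= mu (\bigcup_i ball (d i) e))%E.
Proof.
move=> [D [/countable_injP[g ginj] Dd]] e0.
(* Enumeration of [D] through its coding [g]; a number coding no point yields [0], which merely adds
   a ball. *)
pose d i := xget 0 [set x | D x /\ g x = i].
pose F n := \bigcup_(i in [set i | (i < n)%N]) ball (d i) e.
have mF n : measurable (F n : set (borel X)).
  by apply: open_borel_measurable; apply: bigcup_open => i _; exact: ball_open.
have FT : \bigcup_n F n = setT.
  rewrite -subTset => x _.
  have [||z [zx Dz]] := Dd (ball x e).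
  - by exists x; exact: ballxx.
  - exact: ball_open.
  exists (g z).+1 => //; exists (g z) => //=.
  have [D1 gd] : D (d (g z)) /\ g (d (g z)) = g z.
    by apply: (@xgetPex _ 0 [set x | D x /\ g x = g z]); exists z.
  have -> : d (g z) = z by apply: ginj; rewrite ?inE.
  exact: ball_sym.
have ndF : nondecreasing_seq F.
  move=> m n mn; apply/subsetPset; apply: bigcup_subset => i /= im.
  exact: leq_trans mn.
have mFT : measurable (\bigcup_n F n : set (borel X)) by exact: bigcup_measurable.
have cF : mu (F n) @[n --> \oo] --> 1%E.
  have <- : mu (\bigcup_n F n) = 1%E by rewrite FT; exact: probability_setT.
  exact: nondecreasing_cvg_mu.
have [n hn] : exists n, ((2^-1)%:E <= mu (F n))%E.
  apply: contrapT => /forallNP H.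
  have : (1 <= (2^-1 : R)%:E)%E.
    rewrite -(cvg_lim _ cF)//; apply: lime_le; first by apply/cvg_ex; exists 1%E.
    by apply: nearW => n /=; rewrite ltW// ltNge; apply/negP/H.
  by rewrite lee_fin; lra.
exists n, (fun i => d i); apply: (le_trans hn); apply: le_measure; rewrite ?inE//.
  by apply: open_borel_measurable; apply: bigcup_open => i _; exact: ball_open.
by move=> x [i ij xi]; exists (Ordinal ij).
Qed.

End separable_borel.

(** An ultrafilter on [B] contains a ball of each radius [e]: otherwise it contains the complements
    of finitely many such balls, which together cover [B] since their halves cover the approximating
    compact set. It is thus Cauchy, and completeness and closedness give its limit in [B]. *)
Lemma compact_of_compact_approx {R : realType} {X : completeNormedModType R} (B : set X) :
  closed B ->
  (forall e : R, 0 < e -> exists2 K : set X, compact K &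
     forall h, B h -> exists2 z, K z & `|h - z| < e) ->
  compact B.
Proof.
move=> Bcl Bapp; rewrite compact_ultra => F UF FB.
have cF : cauchy F.
  apply: cauchy_exP => e e0; apply: contrapT => /forallNP nF.
  have e20 : 0 < e / 2 by rewrite divr_gt0.
  have [K cK BK] := Bapp _ e20.
  move: cK; rewrite compact_cover => /(_ _ setT (fun z => ball z (e / 2))).
  case=> [i _|z _|D _ KD]; first exact: ball_open.
    by exists z => //; exact: ballxx.
  have FnB i : F (~` ball i e).
    by have [/nF|] := in_ultra_setVsetC (ball i e) UF.
  have : F (\bigcap_(i in [set` D]) ~` ball i e) by apply: filter_bigI.
  move=> /(filterI FB)/filter_ex[h [/BK[z Kz hz] nh]].
  have [i iD iz] := KD _ Kz; apply: (nh i iD).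
  rewrite [e]splitr; apply: (ball_triangle iz).
  by rewrite -ball_normE/= distrC.
have /cvg_ex[p Fp] : cvg F by exact: cauchy_cvg.
exists p; split=> //; apply: (@closed_cvg _ _ F _ id B Bcl _ p Fp) => //.
Qed.

(** * The Cameron-Martin norm: closed balls, parallelogram law, compactness *)

Section cameron_martin.
Context {R : realType} {X : completeNormedModType R} (mu : probability (borel X) R).
Implicit Types (f g : {linear X -> R^o}) (h k : X) (r s : R).

Definition cm_unit f : Prop :=
  continuous (f : X -> R^o) /\ (\int[mu]_x ((f x : R) ^+ 2)%:E <= 1)%E.

Lemma cm_norm_ub f h : cm_unit f -> ((f h : R)%:E <= cm_norm mu h)%E.
Proof. by move=> uf; apply: ereal_sup_ubound; exists f. Qed.

Lemma cm_norm_leP h r :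
  (cm_norm mu h <= r%:E)%E <-> forall f, cm_unit f -> (f h : R) <= r.
Proof.
split=> [hr f uf|H]; first by rewrite -lee_fin (le_trans (cm_norm_ub h uf)).
by apply: ge_ereal_sup => _ [f uf <-]; rewrite lee_fin H.
Qed.

Lemma cm_unit0 : cm_unit \0.
Proof.
split; first by move=> x; exact: cvg_cst.
by rewrite integral0_eq// => x _ /=; rewrite expr0n.
Qed.

Lemma cm_norm_ge0 h : (0 <= cm_norm mu h)%E.
Proof. exact: (cm_norm_ub h cm_unit0). Qed.

Lemma cm_norm0 : cm_norm mu 0 = 0%E.
Proof.
apply/eqP; rewrite eq_le cm_norm_ge0 andbT.
by apply/cm_norm_leP => f _; rewrite linear0.
Qed.

Lemma cm_normE h : cm_space mu h -> cm_norm mu h = (fine (cm_norm mu h))%:E.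
Proof. by move=> Eh; rewrite fineK// ge0_fin_numE ?cm_norm_ge0. Qed.

Lemma cm_ball_closed r : closed [set h | (cm_norm mu h <= r%:E)%E].
Proof.
rewrite (_ : [set h | _] = \bigcap_(f in cm_unit) (f : X -> R) @^-1` [set x | x <= r]).
  apply: closed_bigI => f [cf _]; apply: preimage_closed; last exact: closed_le.
  by move=> x _; exact: cf.
by apply/seteqP; split=> h /= /cm_norm_leP.
Qed.

(** Zero variance is the new case: [cm_norm_fun_le_gt0] then applies with every positive deviation,
    and one proportional to [f h] excludes [f h > 0]. *)
Lemma cm_norm_fun_le f h r s : continuous (f : X -> R^o) -> 0 <= s ->
  (\int[mu]_x ((f x : R) ^+ 2)%:E <= (s ^+ 2)%:E)%E ->
  (cm_norm mu h <= r%:E)%E -> (f h : R) <= r * s.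
Proof.
move=> cf; rewrite le_eqVlt => /predU1P[<-|s0]; last exact: cm_norm_fun_le_gt0.
move=> f0 hr; rewrite mulr0 leNgt; apply/negP => fh.
have r0 : 0 <= r by rewrite -lee_fin (le_trans (cm_norm_ge0 h)).
(* Chosen so that [f h = 2 (r + 1) e], which exceeds the bound [r e]. *)
pose e := (f h : R) / (2 * (r + 1)).
have e0 : 0 < e by rewrite divr_gt0// mulr_gt0//; lra.
have fe : (\int[mu]_x ((f x : R) ^+ 2)%:E <= (e ^+ 2)%:E)%E.
  by apply: (le_trans f0); rewrite lee_fin expr0n/= sqr_ge0.
have := cm_norm_fun_le_gt0 cf e0 fe hr.
have fhE : (f h : R) = 2 * (r + 1) * e.
  by rewrite /e mulrC divfK// gt_eqF// mulr_gt0// ltr_wpDl.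
clear -fhE e0 r0; rewrite fhE; nra.
Qed.

(** The parallelogram law by duality, without an inner product. With [a = f (h + k)] and
    [b = g (h - k)], the sum [a^2 + b^2] equals [F1 h + F2 k] for [F1 = a f + b g] and
    [F2 = a f - b g], whose variances add up to at most [2 (a^2 + b^2)]. *)
Lemma cm_parallelogram_unit f g h k r s : cm_unit f -> cm_unit g ->
  (cm_norm mu h <= r%:E)%E -> (cm_norm mu k <= s%:E)%E ->
  (f (h + k) : R) ^+ 2 + (g (h - k) : R) ^+ 2 <= 2 * (r ^+ 2 + s ^+ 2).
Proof.
move=> [cf f1] [cg g1] hr ks.
set a : R := f (h + k); set b : R := g (h - k).
pose F1 : {linear X -> R^o} := (a \*: f) \+ (b \*: g).
pose F2 : {linear X -> R^o} := (a \*: f) \- (b \*: g).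
have c1 : continuous (F1 : X -> R^o).
  by move=> x; apply: (@cvgD R R^o); [exact: (@cvgZl_tmp R R^o X _ _ a _ _ (cf x))|
    exact: (@cvgZl_tmp R R^o X _ _ b _ _ (cg x))].
have c2 : continuous (F2 : X -> R^o).
  by move=> x; apply: (@cvgB R R^o); [exact: (@cvgZl_tmp R R^o X _ _ a _ _ (cf x))|
    exact: (@cvgZl_tmp R R^o X _ _ b _ _ (cg x))].
have mm (F : {linear X -> R^o}) : continuous (F : X -> R^o) ->
    measurable_fun [set: borel X] (fun x => ((F x : R) ^+ 2)%:E).
  move=> cF; apply/measurable_EFinP; apply: measurable_funX.
  exact: continuous_borel_measurable.
have pos (F : {linear X -> R^o}) : (0 <= \int[mu]_x ((F x : R) ^+ 2)%:E)%E.
  by apply: integral_ge0 => x _; rewrite lee_fin sqr_ge0.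
have sum : (\int[mu]_x ((F1 x : R) ^+ 2)%:E + \int[mu]_x ((F2 x : R) ^+ 2)%:E
    <= (2 * (a ^+ 2 + b ^+ 2))%:E)%E.
  rewrite -ge0_integralD//; [|by move=> *; rewrite lee_fin sqr_ge0|exact: (mm F1 c1)
    |by move=> *; rewrite lee_fin sqr_ge0|exact: (mm F2 c2)].
  have -> : (\int[mu]_x (((F1 x : R) ^+ 2)%:E + ((F2 x : R) ^+ 2)%:E) =
     \int[mu]_x ((2 * a ^+ 2)%:E * ((f x : R) ^+ 2)%:E + (2 * b ^+ 2)%:E * ((g x : R) ^+ 2)%:E))%E.
    apply: eq_integral => x _; rewrite -!EFinM -!EFinD /F1 /F2 /=.
    by congr EFin; rewrite /GRing.scale/=; ring.
  have a0 : 0 <= 2 * a ^+ 2 by rewrite mulr_ge0// sqr_ge0.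
  have b0 : 0 <= 2 * b ^+ 2 by rewrite mulr_ge0// sqr_ge0.
  rewrite ge0_integralD//=.
  - rewrite !ge0_integralZl//=; try (exact: mm); try (by move=> *; rewrite lee_fin sqr_ge0).
    rewrite mulrDr EFinD leeD// -[leRHS]mule1; exact: lee_wpmul2l.
  - by move=> x _; rewrite mule_ge0// lee_fin sqr_ge0.
  - by apply: emeasurable_funM; [exact: measurable_cst|exact: mm].
  - by move=> x _; rewrite mule_ge0// lee_fin sqr_ge0.
  - by apply: emeasurable_funM; [exact: measurable_cst|exact: mm].
have fin1 : (\int[mu]_x ((F1 x : R) ^+ 2)%:E)%E \is a fin_num.
  rewrite ge0_fin_numE//; apply: le_lt_trans (ltry (2 * (a ^+ 2 + b ^+ 2))).
  by apply: le_trans sum; rewrite leeDl.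
have fin2 : (\int[mu]_x ((F2 x : R) ^+ 2)%:E)%E \is a fin_num.
  rewrite ge0_fin_numE//; apply: le_lt_trans (ltry (2 * (a ^+ 2 + b ^+ 2))).
  by apply: le_trans sum; rewrite leeDr.
move: sum (pos F1) (pos F2).
rewrite -(fineK fin1) -(fineK fin2).
set v1 := fine _; set v2 := fine _.
rewrite -EFinD !lee_fin => sum v10 v20.
have l1 : (F1 h : R) <= r * Num.sqrt v1.
  by apply: cm_norm_fun_le => //; rewrite sqr_sqrtr// fineK.
have l2 : (F2 k : R) <= s * Num.sqrt v2.
  by apply: cm_norm_fun_le => //; rewrite sqr_sqrtr// fineK.
have Q : a ^+ 2 + b ^+ 2 = (F1 h : R) + (F2 k : R).
  rewrite /F1 /F2 /= /GRing.scale/= !expr2 {2}/a {2}/b linearD linearB/=.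
  by ring.
have q1 := sqr_sqrtr v10; have q2 := sqr_sqrtr v20.
(* These squares give [4 r sqrt v1 <= 4 r^2 + v1] and its analogue for [s] and [v2]; the variances
   are then absorbed on the left. *)
have := sqr_ge0 (2 * r - Num.sqrt v1); have := sqr_ge0 (2 * s - Num.sqrt v2).
by rewrite !sqrrB !exprMn q1 q2; lra.
Qed.

(** Taking the supremum over the second functional turns the parallelogram bound into one on the
    norm of [h - k], which is useful when [f] nearly attains the norm of [h + k]. *)
Lemma cm_norm_sub_le f h k r s : cm_unit f ->
  (cm_norm mu h <= r%:E)%E -> (cm_norm mu k <= s%:E)%E ->
  (cm_norm mu (h - k)%R <= (Num.sqrt (2 * (r ^+ 2 + s ^+ 2) - (f (h + k) : R) ^+ 2)%R)%:E)%E.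
Proof.
move=> uf hr ks; apply/cm_norm_leP => g ug.
apply: le_trans (ler_norm _) _; rewrite -sqrtr_sqr ler_wsqrtr//.
by have := cm_parallelogram_unit uf ug hr ks; lra.
Qed.

Hypotheses (sepX : separable X) (gm : centred_gaussian mu).

Lemma cm_ball_compact r : 0 < r -> compact [set h | (cm_norm mu h <= r%:E)%E].
Proof.
move=> r0; apply: compact_of_compact_approx; first exact: cm_ball_closed.
move=> eps eps0; pose e := eps / (21 * r).
have e0 : 0 < e by rewrite divr_gt0// mulr_gt0.
have [n [d cov]] := separable_cover_half mu sepX e0.
exists [set \sum_i c ord0 i *: d i | c in
   [set c : 'rV[R]_n | forall i, `[(- (21 * r)), (21 * r)]%classic (c ord0 i)]].
  exact: span_image_compact.
move=> h hr.
(* Bounding [f h] now bounds the gauge of [h]. *)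
have [f [fp fh]] := hahn_banach_point h (span_gauge_sublinear d e0).
have fnorm x : `|f x : R| <= `|x| / e.
  rewrite ler_norml lerNl -linearN; apply/andP; split.
    by rewrite (le_trans (fp _))// -(normrN x) span_gauge_le_norm.
  by rewrite (le_trans (fp _))// span_gauge_le_norm.
have cf : continuous (f : X -> R^o).
  apply: bounded_linear_continuous; apply/linear_boundedP.
  apply: filterS (nbhs_pinfty_ge (num_real e^-1)) => M eM x.
  by apply: (le_trans (fnorm x)); rewrite mulrC ler_wpM2r.
have fd i : `|f (d i) : R| <= 1.
  rewrite ler_norml lerNl -linearN; apply/andP; split.
    by rewrite (le_trans (fp _))// -scaleN1r span_gauge_le1// normrN1.
  by rewrite (le_trans (fp _))// -[d i]scale1r span_gauge_le1// normr1.
(* Since [|f| <= 2] on half of the mass, the variance is at most [96 * 2^2 = 384], below [20^2]. *)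
have var : (\int[mu]_x ((f x : R) ^+ 2)%:E <= (20 ^+ 2)%:E)%E.
  have half : ((2^-1)%:E <= mu [set x | (`|f x : R| <= 2)%R])%E.
    apply: (le_trans cov); apply: le_measure; [apply/mem_set|apply/mem_set|].
    - apply: (@open_borel_measurable _ X); apply: bigcup_open => i _.
      exact: ball_open.
    - rewrite -[X in measurable X]setTI.
      have mf : measurable_fun [set: borel X] (f : X -> R).
        exact: continuous_borel_measurable.
      have mnf : measurable_fun [set: borel X] (fun x => `|f x : R|).
        exact: measurableT_comp.
      rewrite (_ : [set x | _] = (fun x => `|f x : R|) @^-1` `]-oo, 2]%classic).
        exact: mnf.
      by apply/seteqP; split=> x /=; rewrite in_itv.
    move=> x [i _]; rewrite -ball_normE/= distrC => xi.
    rewrite -(subrK (d i) x) linearD (le_trans (ler_normD _ _))//.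
    have -> : 2 = 1 + 1 :> R by [].
    by rewrite lerD// (le_trans (fnorm _))// ler_pdivrMr// mul1r ltW.
  apply: (le_trans (gaussian_sqr_integral_le gm cf _ half)) => //.
  by rewrite lee_fin; lra.
(* The slack between [20 r] and [21 r] lets some [c] achieve a cost below [21 r]; that cost controls
   both the coefficients and the distance, with [21 r e = eps]. *)
have hp : span_gauge d e h < 21 * r.
  rewrite -fh; apply: (@le_lt_trans _ _ (r * 20)); last by lra.
  exact: (cm_norm_fun_le_gt0 cf _ var hr).
have [_ [c _ <-] chr] := inf_lt (has_inf_span_cost d e0 h).1 hp.
exists (\sum_i c ord0 i *: d i).
  exists c => // i /=; rewrite in_itv/= -ler_norml.
  apply: ltW; apply: le_lt_trans chr; rewrite /span_cost [leRHS]addrC (bigD1 i)//= -addrA lerDl.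
  by apply: addr_ge0; [exact: sumr_ge0|rewrite divr_ge0// ltW].
have : `|h - \sum_i c ord0 i *: d i| / e < 21 * r.
  by apply: le_lt_trans chr; rewrite /span_cost lerDl sumr_ge0.
by rewrite ltr_pdivrMr// /e mulrC divfK// mulf_neq0// gt_eqF.
Qed.

End cameron_martin.

(** * Subsequences, and the support of a probability measure *)

Lemma compact_subsequence {R : realType} {T : pseudoMetricType R} (K : set T)
    (x : nat -> T) : compact K -> (forall n, K (x n)) ->
  exists (p : T) (phi : nat -> nat), [/\ K p,
    (forall m n, (m < n)%N -> (phi m < phi n)%N) & x (phi n) @[n --> \oo] --> p].
Proof.
move=> cK Kx.
have [|p [Kp clp]] := cK (x n @[n --> \oo]) _; first by exists 0%N => //= n _; exact: Kx.
(* The pair holds the rank of the term to be chosen and the last index used, so iteration yields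
   increasing indices and radii tending to zero. *)
have step (kn : nat * nat) : exists m, (kn.2 < m)%N /\ ball p kn.1.+1%:R^-1 (x m).
  have [||_ [[m /= nm <-] bm]] :=
    clp [set x m | m in [set m | (kn.2 < m)%N]] (ball p kn.1.+1%:R^-1).
  - by exists kn.2.+1 => // m /= nm; exists m.
  - exact: nbhsx_ballx.
  by exists m.
have [f fP] := choice step.
pose phi := fix phi n := if n is n'.+1 then f (n, phi n') else f (0%N, 0%N).
exists p, phi; split=> //.
  apply: (@homo_ltn _ phi (fun i j => (i < j)%N)) => [? ? ?|n].
    exact: ltn_trans.
  exact: (fP (n.+1, phi n)).1.
have phiP n : ball p n.+1%:R^-1 (x (phi n)).
  by case: n => [|n]; [exact: (fP (0, 0)%N).2|exact: (fP (n.+1, phi n)).2].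
apply/cvg_ballP => e e0.
apply: filterS (near_infty_natSinv_lt (PosNum e0)) => n /ltW ne.
exact: le_ball ne _ (phiP n).
Qed.

Lemma within_continuous_cvg {T U : topologicalType} (S : set T) (f : T -> U)
    (a_ : nat -> T) (a : T) : {within S, continuous f} ->
  (forall n, S (a_ n)) -> S a -> a_ n @[n --> \oo] --> a ->
  f (a_ n) @[n --> \oo] --> f a.
Proof.
move=> /subspace_continuousP cf Sa_ Sa cva; apply: cvg_comp (cf a Sa) => A hA.
have h : \forall n \near \oo, S (a_ n) -> A (a_ n) by exact: cva hA.
change (\forall n \near \oo, A (a_ n)).
by apply: filterS h => n; apply; exact: Sa_.
Qed.

(** If the support were empty, every point would have a null neighbourhood; finitely many of these
    cover each cube, and countably many cubes exhaust the space, whose mass is one. *)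
Lemma measure_support_nonempty {R : realType} {k : nat}
  (nu : probability (borel 'rV[R]_k) R) : measure_support nu !=set0.
Proof.
apply/set0P/negP => /eqP S0.
have null x : exists U : set 'rV[R]_k, [/\ open U, U x & nu U = 0%E].
  have : ~ measure_support nu x by rewrite S0.
  move=> /existsNP[U] /not_implyP[oU] /not_implyP[Ux nU]; exists U; split=> //.
  by apply/eqP; rewrite eq_le measure_ge0 andbT leNgt; apply/negP.
have [U UP] := choice null.
pose B n := [set v : 'rV[R]_k | forall i, `[(- n%:R), n%:R]%classic (v ord0 i)].
have Bnull n : nu.-negligible (B n : set (borel 'rV[R]_k)).
  have : compact (B n) by exact: rV_cube_compact.
  rewrite compact_cover => /(_ _ setT U) [i _|v _|D _ BD].
  - by have [] := UP i.
  - by exists v => //; have [] := UP v.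
  apply: (@negligibleS _ _ _ nu _ _ BD); rewrite /cover bigcup_fset.
  elim/big_ind : _ => [|A C|i _]; first exact: negligible_set0.
    exact: negligibleU.
  exists (U i); split=> //; have [? _ ?] := UP i => //.
  exact: sub_sigma_algebra.
have BT : setT `<=` \bigcup_n B n.
  move=> v _; exists (Num.truncn (\sum_i `|v ord0 i|)).+1 => // i /=.
  rewrite in_itv/= -ler_norml; apply: ltW.
  apply: le_lt_trans (truncnS_gt _).
  by rewrite (bigD1 i)//= lerDl sumr_ge0.
have Tnull : nu.-negligible (\bigcup_n B n : set (borel 'rV[R]_k)).
  exact: negligible_bigcup.
have := @negligibleS _ _ _ nu _ _ BT Tnull.
move=> /(negligibleP _ measurableT) nu0.
have := @probability_setT _ _ _ nu; rewrite nu0 => /eqP.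
by rewrite eq_sym onee_eq0.
Qed.

(** * The functional [K] on the support *)

Section prior_density.
Context {R : realType} {k : nat} (S : set 'rV[R]_k) (rho : 'rV[R]_k -> R).
Hypotheses (rho_ge0 : forall a, 0 <= rho a) (crho : {within S, continuous rho}).
Hypotheses (rho_int : forall a, S° a -> 0 < rho a) (Sint : S `<=` closure S°).

(** Every point of [S] is adherent to the interior, so continuity of [rho] on [S] identifies the
    boundary limit. Zeros of [rho] are separated because [ln 0] is [0] by convention, whereas there
    the limit of [ln (rho b)] is [-oo]. *)
Lemma K_priorE a : S a ->
  K_prior S rho a = if 0 < rho a then (- ln (rho a))%:E else +oo%E.
Proof.
move=> Sa; rewrite /K_prior.
case: asboolP => [Sia|_]; first by rewrite rho_int.
case: asboolP => // _.
have PF : ProperFilter (within S° (nbhs a)) by apply: within_nbhs_proper; exact: Sint.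
have crhoa : rho b @[b --> within S° (nbhs a)] --> rho a.
  have /subspace_continuousP/(_ a Sa) h := crho.
  by apply: cvg_trans h; apply: cvg_app; apply: within_subset; exact: interior_subset.
case: ltP => [ra|ra].
  have /cvg_lim -> // : (ln (rho b))%:E @[b --> within S° (nbhs a)] --> (ln (rho a))%:E.
  apply: cvg_EFin; first exact: nearW.
  exact: (cvg_comp _ _ crhoa (continuous_ln ra)).
have ra0 : rho a = 0 by apply/eqP; rewrite eq_le ra rho_ge0.
have /cvg_lim -> // : (ln (rho b))%:E @[b --> within S° (nbhs a)] --> -oo%E.
apply/cvgeNyPle => A.
have : \forall b \near within S° (nbhs a), rho b < expR A.
  by apply: (cvgr_lt _ crhoa); rewrite ra0 expR_gt0.
have : \forall b \near within S° (nbhs a), S° b by exact: withinT.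
apply: filterS2 => b Sb rb; rewrite lee_fin -[leRHS]expRK ler_ln ?posrE ?expR_gt0//.
  exact: ltW.
exact: rho_int.
Qed.

Lemma K_prior_lower_bound : compact S ->
  exists K0 : R, forall a, S a -> (K0%:E <= K_prior S rho a)%E.
Proof.
move=> cS; have : compact (rho @` S) by exact: continuous_compact.
move=> /compact_bounded/ex_strict_bound_gt0[M M0 rM].
exists (- ln M) => a Sa; rewrite K_priorE//; case: ifPn => // ra; last by rewrite leey.
rewrite lee_fin lerN2 ler_ln ?posrE//.
by apply: (le_trans (ler_norm _)); apply: ltW; apply: rM; exists a.
Qed.

(** The bound [c] keeps [rho] above [exp (- c)] along the sequence, hence at the limit, where [ln]
    is then continuous. *)
Lemma K_prior_cvg (a_ : nat -> 'rV[R]_k) (a : 'rV[R]_k) (c : R) :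
  (forall n, S (a_ n)) -> S a -> a_ n @[n --> \oo] --> a ->
  (forall n, (K_prior S rho (a_ n) <= c%:E)%E) ->
  K_prior S rho a \is a fin_num /\
  fine (K_prior S rho (a_ n)) @[n --> \oo] --> fine (K_prior S rho a).
Proof.
move=> Sa_ Sa cva Kc.
have cvr := within_continuous_cvg crho Sa_ Sa cva.
have rpos n : 0 < rho (a_ n).
  by move: (Kc n); rewrite K_priorE//; case: ltP.
have rge n : expR (- c) <= rho (a_ n).
  move: (Kc n); rewrite K_priorE// rpos lee_fin lerNl => h.
  by rewrite -(lnK (rpos n)) ler_expR.
have ra : 0 < rho a.
  apply: lt_le_trans (expR_gt0 (- c)) _.
  by apply: (cvgr_to_ge cvr); exact: nearW.
split; first by rewrite K_priorE// ra.
rewrite K_priorE// ra /=; under eq_cvg do rewrite K_priorE// rpos/=.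
by apply: cvgN; exact: (cvg_comp _ _ cvr (continuous_ln ra)).
Qed.

End prior_density.

(** * Coercivity, and passage to the limit in the norm and the potential *)

Section cm_convergence.
Context {R : realType} {X : completeNormedModType R} (mu : probability (borel X) R).
Local Notation N h := (fine (cm_norm mu h)).

(** The compact unit ball of [E] is bounded in [X]. Dividing [h] by [N h + 1] instead of [N h]
    covers norm zero as well, and [(N h + 1)^2 <= 2 (N h^2 + 1)]. *)
Lemma cm_norm_coercive : separable X -> centred_gaussian mu ->
  exists2 C : R, 0 < C & forall h : X, cm_space mu h -> `|h| ^+ 2 <= C * (N h ^+ 2 + 1).
Proof.
move=> sX gm.
have := cm_ball_compact sX gm ltr01.
move=> /compact_bounded/ex_strict_bound_gt0[M M0 bM].
exists (2 * M ^+ 2) => [|h Eh]; first by rewrite mulr_gt0// exprn_gt0.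
have N0 : 0 <= N h by rewrite fine_ge0// cm_norm_ge0.
have r0 : 0 < N h + 1 by rewrite ltr_wpDl.
have : `|(N h + 1)^-1 *: h| < M.
  apply: bM; apply/cm_norm_leP => f uf; rewrite linearZ /GRing.scale/=.
  rewrite ler_pdivrMl// mulr1 (@le_trans _ _ (N h)) ?lerDl//.
  by rewrite -lee_fin -cm_normE//; exact: cm_norm_ub.
rewrite normrZ gtr0_norm ?invr_gt0// ltr_pdivrMl// => hM.
have : `|h| ^+ 2 <= ((N h + 1) * M) ^+ 2.
  by rewrite ler_sqr ?nnegrE// ?mulr_ge0 ?(ltW r0) ?(ltW M0)// ltW.
have := mulr_ge0 (sqr_ge0 M) (sqr_ge0 (N h - 1)).
have -> : ((N h + 1) * M) ^+ 2 = 2 * M ^+ 2 * (N h ^+ 2 + 1) - M ^+ 2 * (N h - 1) ^+ 2 by ring.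
by lra.
Qed.

Lemma cm_norm_le_lim (u_ : nat -> X) (u : X) (l : R) :
  (forall n, cm_space mu (u_ n)) -> u_ n @[n --> \oo] --> u ->
  N (u_ n) @[n --> \oo] --> l -> (cm_norm mu u <= l%:E)%E.
Proof.
move=> Eu_ cu cN; apply/cm_norm_leP => f uf.
have cfu : (f (u_ n) : R) @[n --> \oo] --> (f u : R).
  exact: (cvg_comp _ _ cu (uf.1 u)).
apply: (ler_cvg_to cfu cN); apply: nearW => n.
by rewrite -lee_fin -cm_normE//; exact: cm_norm_ub.
Qed.

(* The parallelogram law bounds [cm_norm (u_ n - u)] by a quantity whose limit is
   arbitrarily small when [f u] is close to [cm_norm u]. *)
Lemma cm_norm_cvg (u_ : nat -> X) (u : X) :
  (forall n, cm_space mu (u_ n)) -> cm_space mu u -> u_ n @[n --> \oo] --> u ->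
  N (u_ n) @[n --> \oo] --> N u ->
  cm_norm mu (u_ n - u) @[n --> \oo] --> 0%E.
Proof.
move=> Eu_ Eu cu cN.
have N0 h : 0 <= N h by rewrite fine_ge0// cm_norm_ge0.
have near_small (e : R) : 0 < e -> \forall n \near \oo, (cm_norm mu (u_ n - u)%R < e%:E)%E.
  (* The limit of the parallelogram bound is [4 (N u^2 - (f u)^2)], at most [8 d N u] when [f u] is
     within [d] of [N u], hence below [e^2]. *)
  move=> e0; pose d := e ^+ 2 / (16 * (N u + 1)).
  have d0 : 0 < d by rewrite divr_gt0 ?exprn_gt0// mulr_gt0// ltr_wpDl.
  have [f [uf fu]] : exists f, cm_unit mu f /\ N u - d < (f u : R).
    apply: contrapT => /forallNP H.
    have : (cm_norm mu u <= (N u - d)%:E)%E.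
      apply/cm_norm_leP => f uf; rewrite leNgt; apply/negP => fu.
      by apply: (H f).
    by rewrite cm_normE// lee_fin lerDl oppr_ge0 leNgt d0.
  have fN : (f u : R) <= N u by rewrite -lee_fin -cm_normE//; exact: cm_norm_ub.
  have cfu : (f (u_ n + u) : R) @[n --> \oo] --> (f u + f u : R).
    under eq_cvg do rewrite linearD.
    apply: cvgD; last exact: cvg_cst.
    exact: (cvg_comp _ _ cu (uf.1 u)).
  have cw : 2 * (N (u_ n) ^+ 2 + N u ^+ 2) - (f (u_ n + u) : R) ^+ 2 @[n --> \oo] -->
      2 * (N u ^+ 2 + N u ^+ 2) - (f u + f u : R) ^+ 2.
    apply: cvgB; last exact: (cvgM cfu cfu).
    apply: cvgM; first exact: cvg_cst.
    by apply: cvgD; [exact: (cvgM cN cN)|exact: cvg_cst].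
  have lim_small : 2 * (N u ^+ 2 + N u ^+ 2) - (f u + f u : R) ^+ 2 < e ^+ 2.
    have de : d * (16 * (N u + 1)) = e ^+ 2.
      by rewrite /d divfK// gt_eqF// mulr_gt0// ltr_wpDl.
    have := N0 u; move: (N u) (f u : R) fu fN de e0 d0 => {uf cfu cw} z t; nra.
  have : \forall n \near \oo,
      2 * (N (u_ n) ^+ 2 + N u ^+ 2) - (f (u_ n + u) : R) ^+ 2 < e ^+ 2.
    exact: (cvgr_lt _ cw).
  apply: filterS => n wn.
  have := cm_norm_sub_le (h := u_ n) (k := u) (r := N (u_ n)) (s := N u) uf.
  rewrite -!cm_normE// => /(_ (lexx _) (lexx _)) /le_lt_trans; apply.
  rewrite lte_fin -[ltRHS]ger0_norm ?(ltW e0)// -sqrtr_sqr ltr_sqrt//.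
  by rewrite exprn_gt0.
apply/fine_cvgP; split.
  apply: filterS (near_small 1 ltr01) => n n1.
  by rewrite ge0_fin_numE ?cm_norm_ge0// (lt_trans n1) ?ltry.
apply/cvgrPdist_lt => e e0; apply: filterS (near_small e e0) => n ne.
rewrite sub0r normrN ger0_norm ?N0// -lte_fin fineK//.
by rewrite ge0_fin_numE ?cm_norm_ge0// (lt_trans ne) ?ltry.
Qed.

End cm_convergence.

(** Condition (A4) controls the change in [u], uniformly enough since [M3 r (a_ n) y] converges, and
    (A2) the change in [a] with [u] fixed. *)
Lemma potential_cvg {R : realType} {X : completeNormedModType R} {k J : nat}
    (Lambda : set 'rV[R]_k) (Phi : X -> 'rV[R]_k -> 'rV[R]_J -> R) (y : 'rV[R]_J)
    (u_ : nat -> X) (u : X) (a_ : nat -> 'rV[R]_k) (a : 'rV[R]_k) :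
  potential_A2 Lambda Phi -> potential_A4 Lambda Phi ->
  (forall n, Lambda (a_ n)) -> Lambda a ->
  u_ n @[n --> \oo] --> u -> a_ n @[n --> \oo] --> a ->
  Phi (u_ n) (a_ n) y @[n --> \oo] --> Phi u a y.
Proof.
move=> A2 [M3 [_ M3c A4]] La_ La cu ca.
have c1 := within_continuous_cvg (A2 u y) La_ La ca.
pose r := `|u| + 1.
have r0 : 0 < r by rewrite ltr_wpDl.
have c2 := within_continuous_cvg (M3c r y (ltW r0)) La_ La ca.
have cd : `|u_ n - u| @[n --> \oo] --> (0 : R).
  rewrite -(normr0 X) -(subrr u); apply: cvg_norm; apply: cvgB => //; exact: cvg_cst.
have cb : M3 r (a_ n) y * `|u_ n - u| @[n --> \oo] --> (0 : R).
  by rewrite -(mulr0 (M3 r a y)); exact: cvgM.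
have cdiff : Phi (u_ n) (a_ n) y - Phi u (a_ n) y @[n --> \oo] --> (0 : R).
  apply: (squeeze_cvgr (f := fun n => - (M3 r (a_ n) y * `|u_ n - u|))
    (h := fun n => M3 r (a_ n) y * `|u_ n - u|)) => //; last first.
    by rewrite -oppr0; exact: cvgN.
  have : \forall n \near \oo, `|u_ n| < r.
    by apply: (cvgr_lt _ (cvg_norm cu)); rewrite ltrDl.
  apply: filterS => n un; rewrite -ler_norml.
  by apply: A4 => //; rewrite ltrDl.
rewrite -[Phi u a y]add0r.
have -> : (fun n => Phi (u_ n) (a_ n) y) =
   (fun n => (Phi (u_ n) (a_ n) y - Phi u (a_ n) y) + Phi u (a_ n) y).
  by apply/funext => n; rewrite subrK.
exact: cvgD.
Qed.

(** * Minimisers, and strong convergence of minimising sequences *)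

Unset Implicit Arguments.

Theorem theorem5p2 (R : realType) (X : completeNormedModType R) (k J : nat)
    (Lambda : set 'rV[R]_k)
    (mu0 : probability (borel X) R)
    (lam : {measure set (borel 'rV[R]_k) -> \bar R})
    (nu0 : probability (borel 'rV[R]_k) R)
    (rho : 'rV[R]_k -> R)
    (Phi : X -> 'rV[R]_k -> 'rV[R]_J -> R) (y : 'rV[R]_J) :
  let S := measure_support nu0 in
  let E := cm_space mu0 in
  let I := objective mu0 S rho (fun u a => Phi u a y) in
  let infI := ereal_inf [set I u a | u in E & a in S] in
  separable X ->
  centred_gaussian mu0 ->
  compact S -> S `<=` Lambda ->
  is_lebesgue_rV lam -> has_density lam nu0 rho ->
  {within S, continuous rho} ->
  (forall a, S° a -> 0 < rho a) ->
  S `<=` closure S° ->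
  potential_A1 Lambda Phi -> potential_A2 Lambda Phi ->
  potential_A3 Lambda Phi -> potential_A4 Lambda Phi ->
  (exists ubar abar, [/\ E ubar, S abar & I ubar abar = infI]) /\
  (forall (u_ : nat -> X) (a_ : nat -> 'rV[R]_k),
     (forall n, E (u_ n) /\ S (a_ n)) ->
     I (u_ n) (a_ n) @[n --> \oo] --> infI ->
     exists ubar abar (phi : nat -> nat),
       [/\ [/\ E ubar, S abar & I ubar abar = infI],
           (forall m n, (m < n)%N -> (phi m < phi n)%N),
           cm_norm mu0 (u_ (phi n) - ubar) @[n --> \oo] --> 0%E &
           a_ (phi n) @[n --> \oo] --> abar]).
Proof.
move=> S E I infI sX gm cS SL _ [_ rho0 _] crho rint Sint A1 A2 _ A4.
have [C C0 coer] := cm_norm_coercive sX gm.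
(* With this [eps], coercivity bounds the loss in (A1) by a quarter of the squared norm of [E] plus
   [1 / 4], so half of the quadratic term of [I] survives. *)
have [M1 PhiM1] : exists M1 : R, forall u a y, Lambda a ->
  M1 - (4 * C)^-1 * `|u| ^+ 2 <= Phi u a y by apply: A1; rewrite invr_gt0 mulr_gt0.
have [K0 K0P] := K_prior_lower_bound rho0 crho rint Sint cS.
pose N (h : X) : R := fine (cm_norm mu0 h).
pose K := K_prior S rho.
pose c : R := M1 - 4^-1.
have N0 h : 0 <= N h by rewrite fine_ge0// cm_norm_ge0.
have Philb u a : E u -> S a -> c - N u ^+ 2 / 4 <= Phi u a y.
  move=> Eu Sa; apply: le_trans (PhiM1 u a y (SL _ Sa)).
  have : (4 * C)^-1 * `|u| ^+ 2 <= (N u ^+ 2 + 1) / 4.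
    rewrite ler_pdivrMl ?mulr_gt0//; apply: (le_trans (coer u Eu)).
    by rewrite -/(N u) mulrC (mulrC 4) -mulrA (mulrC 4) divfK// mulrC.
  by rewrite /c; lra.
have IE u a : E u -> I u a = ((Phi u a y + 2^-1 * N u ^+ 2)%:E + K a)%E.
  by move=> Eu; rewrite /I /objective /J_prior asboolT.
have Ilb u a : E u -> S a -> ((c + K0 + N u ^+ 2 / 4)%:E <= I u a)%E.
  move=> Eu Sa; rewrite IE//; apply: le_trans (leeD (lexx _) (K0P a Sa)).
  by rewrite lee_fin; have := Philb u a Eu Sa; lra.
have IfinE u a : E u -> K a \is a fin_num ->
    I u a = (Phi u a y + 2^-1 * N u ^+ 2 + fine (K a))%:E.
  by move=> Eu Ka; rewrite IE// -{1}(fineK Ka).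
have infle u a : E u -> S a -> (infI <= I u a)%E.
  by move=> Eu Sa; apply: ereal_inf_lbound; exists u => //; exists a.
have inflb : ((c + K0)%:E <= infI)%E.
  apply: le_ereal_inf_tmp => _ [u Eu [a Sa <-]]; apply: le_trans (Ilb u a Eu Sa).
  by rewrite lee_fin lerDl divr_ge0// sqr_ge0.
(* The point [(0, b)] with [b] interior to [S] has finite objective, so the infimum is finite. *)
have [a0 Sa0] := measure_support_nonempty nu0.
have [b [Sib _]] := Sint _ Sa0 setT filterT.
have Sb := interior_subset Sib.
have E0 : E 0 by rewrite /E /cm_space/= cm_norm0.
have inffin : infI \is a fin_num.
  rewrite fin_real//; apply/andP; split; first exact: lt_le_trans (ltNyr _) inflb.
  apply: le_lt_trans (infle 0 b E0 Sb) _.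
  rewrite IfinE ?ltry// /K (K_priorE rho0 crho rint Sint Sb) rint//.
pose m := fine infI.
have infE : infI = m%:E by rewrite fineK.
(* Both claims follow from this one: existence is its application to some minimising sequence. *)
have core (u_ : nat -> X) (a_ : nat -> 'rV[R]_k) :
    (forall n, E (u_ n) /\ S (a_ n)) ->
    I (u_ n) (a_ n) @[n --> \oo] --> infI ->
    exists ubar abar (phi : nat -> nat),
      [/\ [/\ E ubar, S abar & I ubar abar = infI],
          (forall m n, (m < n)%N -> (phi m < phi n)%N),
          cm_norm mu0 (u_ (phi n) - ubar) @[n --> \oo] --> 0%E &
          a_ (phi n) @[n --> \oo] --> abar].
  move=> ES cI.
  have [n0 _ In0] : \forall n \near \oo, (I (u_ n) (a_ n) <= (m + 1)%:E)%E.
    move: cI; rewrite infE => /fine_cvgP[fI cI].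
    have : \forall n \near \oo, fine (I (u_ n) (a_ n)) < m + 1.
      by apply: (cvgr_lt _ cI); rewrite ltrDl.
    apply: filterS2 fI => n fn /ltW; rewrite -lee_fin fineK//.
  (* Bounds the norm as well as its square, since [N <= N^2 + 1 / 4]. *)
  pose r := 4 * (m + 1 - c - K0) + 1.
  have Nsqr n : N (u_ (n0 + n)%N) ^+ 2 / 4 <= m + 1 - c - K0.
    have [Eu Sa] := ES (n0 + n)%N.
    have := le_trans (Ilb _ _ Eu Sa) (In0 (n0 + n)%N (leq_addr _ _)).
    by rewrite lee_fin; lra.
  have r0 : 0 < r.
    by have := Nsqr 0%N; have := sqr_ge0 (N (u_ (n0 + 0)%N)); rewrite /r; lra.
  have Nr n : (cm_norm mu0 (u_ (n0 + n)%N) <= r%:E)%E.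
    have [Eu Sa] := ES (n0 + n)%N.
    rewrite cm_normE// lee_fin -/(N _).
    have := Nsqr n; have := sqr_ge0 (N (u_ (n0 + n)%N) - 2^-1); rewrite /r sqrrB.
    by lra.
  (* The remaining terms of [I] are at least [c], so [K] stays bounded and the limit avoids the
     zeros of [rho]. *)
  have Kc n : (K (a_ (n0 + n)%N) <= (m + 1 - c)%:E)%E.
    have [Eu Sa] := ES (n0 + n)%N.
    have := In0 (n0 + n)%N (leq_addr _ _); rewrite /= IE// => H.
    rewrite -(@leeD2lE _
      (Phi (u_ (n0 + n)%N) (a_ (n0 + n)%N) y + 2^-1 * N (u_ (n0 + n)%N) ^+ 2)%:E)//.
    apply: (le_trans H); rewrite -EFinD lee_fin.
    have := Philb _ _ Eu Sa; have := sqr_ge0 (N (u_ (n0 + n)%N)); lra.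
  have [p [phi [Kp phiI cp]]] := compact_subsequence
    (x := fun n => (u_ (n0 + n)%N, a_ (n0 + n)%N))
    (compact_setX (cm_ball_compact sX gm r0) cS)
    (fun n => conj (Nr n) (ES (n0 + n)%N).2).
  move: p Kp cp => [ubar abar] [/= ur Sabar] cp.
  pose psi n := (n0 + phi n)%N.
  have cu : u_ (psi n) @[n --> \oo] --> ubar by exact: (cvg_comp _ _ cp cvg_fst).
  have ca : a_ (psi n) @[n --> \oo] --> abar by exact: (cvg_comp _ _ cp cvg_snd).
  have Eubar : E ubar by rewrite /E /cm_space/=; exact: le_lt_trans ur (ltry _).
  have Eu n : E (u_ (psi n)) := (ES (psi n)).1.
  have Sa n : S (a_ (psi n)) := (ES (psi n)).2.
  have cPhi : Phi (u_ (psi n)) (a_ (psi n)) y @[n --> \oo] --> Phi ubar abar y.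
    apply: (potential_cvg A2 A4) => // [n|]; exact: SL.
  have [Kfin cK] := K_prior_cvg rho0 crho rint Sint Sa Sabar ca (fun n => Kc (phi n)).
  have Kafin n : K (a_ (psi n)) \is a fin_num.
    rewrite fin_real//; apply/andP; split.
      exact: lt_le_trans (ltNyr _) (K0P _ (Sa n)).
    exact: le_lt_trans (Kc (phi n)) (ltry _).
  have cIpsi : fine (I (u_ (psi n)) (a_ (psi n))) @[n --> \oo] --> m.
    move: cI; rewrite infE => /fine_cvgP[_ cI].
    apply: (cvg_comp psi _ _ cI) => A [n1 _ An1].
    exists n1 => // n /= n1n; apply: An1 => /=; apply: (leq_trans n1n).
    apply: leq_trans (leq_addl _ _).
    by elim: n {n1n} => // n /leq_ltn_trans; apply; exact: phiI.
  (* The limit of the squared norms, forced by the convergence of [I], [Phi] and [K]. *)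
  pose j := 2 * (m - Phi ubar abar y - fine (K abar)).
  have cN2 : N (u_ (psi n)) ^+ 2 @[n --> \oo] --> j.
    have -> : (fun n => N (u_ (psi n)) ^+ 2) = (fun n => 2 * (fine (I (u_ (psi n)) (a_ (psi n)))
        - Phi (u_ (psi n)) (a_ (psi n)) y - fine (K (a_ (psi n))))).
      by apply/funext => n; rewrite IfinE//=; field.
    by apply: cvgM; [exact: cvg_cst|apply: cvgB => //; exact: cvgB].
  have j0 : 0 <= j by apply: (cvgr_to_ge cN2); apply: nearW => n; exact: sqr_ge0.
  have cN : N (u_ (psi n)) @[n --> \oo] --> Num.sqrt j.
    have -> : (fun n => N (u_ (psi n))) = (fun n => Num.sqrt (N (u_ (psi n)) ^+ 2)).
      by apply/funext => n; rewrite sqrtr_sqr ger0_norm.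
    exact: (cvg_comp _ _ cN2 (@sqrt_continuous R j)).
  have Nle : N ubar <= Num.sqrt j.
    rewrite -lee_fin -cm_normE//; exact: cm_norm_le_lim Eu cu cN.
  have Nsq : N ubar ^+ 2 <= j.
    by rewrite -(sqr_sqrtr j0) ler_sqr ?nnegrE ?sqrtr_ge0.
  (* Lower semicontinuity gave [N ubar ^+ 2 <= j]; comparing [I] at the limit with the infimum gives
     the converse, so the norms converge to that of [ubar]. *)
  have := infle ubar abar Eubar Sabar; rewrite infE IfinE// lee_fin => mI.
  have Nj : N ubar ^+ 2 = j.
    by apply: le_anti; rewrite Nsq/= /j; clear -mI; lra.
  have NE : N ubar = Num.sqrt j by rewrite -Nj sqrtr_sqr ger0_norm.
  exists ubar, abar, psi; split=> //.
  - by split=> //; rewrite IfinE//; congr EFin; rewrite Nj /j; field.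
  - by move=> m' n mn; rewrite ltn_add2l; exact: phiI.
  - by apply: cm_norm_cvg => //; rewrite -/(N ubar) NE.
split=> //.
(* A minimising sequence with error [1 / (n + 1)]. *)
have ex n : exists ua : X * 'rV[R]_k, [/\ E ua.1, S ua.2 & (I ua.1 ua.2 < (m + n.+1%:R^-1)%:E)%E].
  have n0 : 0 < n.+1%:R^-1 :> R by rewrite invr_gt0.
  have [_ [u Eu [a Sa <-]] Iua] := lb_ereal_inf_adherent n0 inffin.
  by exists (u, a); split => //; rewrite EFinD -infE.
have [ua uaP] := choice ex.
have ES n : E (ua n).1 /\ S (ua n).2 by have [] := uaP n.
have [|ubar [abar [_ [? _ _ _]]]] := core (fun n => (ua n).1) (fun n => (ua n).2) ES.
  rewrite infE; apply: (squeeze_cvge (f := fun=> m%:E) (h := fun n => (m + n.+1%:R^-1)%:E)).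
  - apply: nearW => n; have [Eu Sa Iu] := uaP n.
    by rewrite -infE infle//= ltW.
  - exact: cvg_cst.
  apply: cvg_EFin; first exact: nearW.
  rewrite -[X in _ --> X]addr0; apply: cvgD; first exact: cvg_cst.
  exact: cvg_harmonic.
by exists ubar, abar.
Qed.
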